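(* Let $\mathcal{Z}$ be a compact subspace of $\mathbb{R}^d$, $P$ a probability distribution on $\mathcal{Z}$, $z_1,\dots,z_n$ iid samples from $P$ with empirical distribution $\hat P$, $\mathcal{F}$ a function class, $\ell:\mathcal{F}\times\mathcal{Z}\to\mathbb{R}$ a loss function, and $f^*\in\arg\min_{f\in\mathcal{F}}\mathbb{E}_P[\ell(f,z)]$. Let $k:\mathcal{Z}\times\mathcal{Z}\to\mathbb{R}$ be a bounded continuous positive definite kernel and $(\mathcal{H},\langle\cdot,\cdot\rangle_{\mathcal{H}})$ the corresponding reproducing kernel Hilbert space (RKHS). Suppose that (i) $\sup_{z\in\mathcal{Z}}\sqrt{k(z,z)}\le K$; (ii) $\ell(f^*,\cdot)\in\mathcal{H}$ with $\|\ell(f^*,\cdot)\|_{\mathcal{H}}\le M$. Then for all $\delta\in(0,1)$, if the ball size is chosen as $\eta=\frac{K}{\sqrt n}\big(1+\sqrt{2\log(1/\delta)}\big)$, the MMD DRO solution $$f^*_{\text{M-dro}}\in\arg\min_{f\in\mathcal{F}}\ \max_{Q:\,D_{\mathrm{MMD}}(Q,\hat P)\le\eta}\mathbb{E}_Q[\ell(f,z)]$$ satisfies $$\mathbb{E}_P[\ell(f^*_{\text{M-dro}},z)]-\mathbb{E}_P[\ell(f^*,z)]\le\frac{2KM}{\sqrt n}\big(1+\sqrt{2\log(1/\delta)}\big)$$ with probability at least $1-\delta$.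
   Context: The probability is over the samples $z_1,\dots,z_n$; $\mathbb{E}_Q[\ell(f,z)]$ is the expectation over $z\sim Q$ with $f$ held fixed (in particular $\mathbb{E}_P[\ell(f^*_{\text{M-dro}},z)]$ is random through the data-dependent $f^*_{\text{M-dro}}$). The empirical distribution is $\hat P=\frac1n\sum_{i=1}^n\delta_{z_i}$. In the DRO problem, $Q$ ranges over all probability distributions on $\mathcal{Z}$. A (symmetric) kernel $k$ is positive definite if $\sum_{i=1}^n\sum_{j=1}^n a_ia_jk(z_i,z_j)\ge0$ for all $n\in\mathbb{N}$, $a_i\in\mathbb{R}$, $z_i\in\mathcal{Z}$. The maximum mean discrepancy (MMD) is $$D_{\mathrm{MMD}}(Q_1,Q_2)=\sup_{h\in\mathcal{H}:\,\|h\|_{\mathcal{H}}\le1}\int h\,\mathrm{d}Q_1-\int h\,\mathrm{d}Q_2 .$$ It is implicitly assumed that $f^*$ and $f^*_{\text{M-dro}}$ exist, that the expectations and maxima appearing are well defined, and that the relevant events are measurable. *)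

(* Defs.v *)
From HB Require Import structures.
From mathcomp Require Import all_boot all_order all_algebra.
From mathcomp Require Import all_classical all_reals all_analysis.

Set Implicit Arguments.
Unset Strict Implicit.
Unset Printing Implicit Defensive.

Import Order.TTheory GRing.Theory Num.Theory.
Import numFieldNormedType.Exports.

Local Open Scope classical_set_scope.
Local Open Scope ring_scope.

(* [borel t0] is the topological space [T] with its Borel sigma-algebra. The
   point [t0] is there only because every [measurableType] is pointed; neither
   the topology nor the sigma-algebra depends on it. *)
Definition borel (T : topologicalType) (t0 : T) : Type := T.

Section borel_instances.
Variables (T : topologicalType) (t0 : T).

HB.instance Definition _ := Topological.copy (borel t0) T.
HB.instance Definition _ := isPointed.Build (borel t0) t0.

Let borelC (A : set (borel t0)) :
  <<s @open (borel t0) >> A -> <<s @open (borel t0) >> (~` A).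
Proof. by move=> sA; rewrite -setTD; exact: sigma_algebraCD. Qed.

HB.instance Definition _ := @isMeasurable.Build (sigma_display (@open (borel t0)))
  (borel t0) <<s @open (borel t0) >> (@sigma_algebra0 _ setT _) borelC
  (@sigma_algebra_bigcup _ setT _).

End borel_instances.

Section kernels.
Variables (R : realType) (T : Type).
Implicit Types (k : T -> T -> R) (f g h : T -> R).

Definition pd_kernel k : Prop :=
  (forall x y, k x y = k y x) /\
  (forall (n : nat) (a : 'I_n -> R) (z : 'I_n -> T),
     0 <= \sum_(i < n) \sum_(j < n) a i * a j * k (z i) (z j)).

(* The reproducing kernel Hilbert space of [k]: a linear space [rkhs_fun] of
   functions, complete for the norm of an inner product (whose values matter
   on [rkhs_fun] only), that contains every [k z] and in which [k z]
   represents the evaluation at [z]. *)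
Record rkhs k := RKHS {
  rkhs_fun : set (T -> R) ;
  rkhs_inner : (T -> R) -> (T -> R) -> R ;
  rkhs_fun0 : rkhs_fun (cst 0) ;
  rkhs_linear : forall (a : R) f g, rkhs_fun f -> rkhs_fun g ->
    rkhs_fun (fun x => a * f x + g x) ;
  rkhs_innerC : forall f g, rkhs_fun f -> rkhs_fun g ->
    rkhs_inner f g = rkhs_inner g f ;
  rkhs_innerDl : forall (a : R) f g h,
    rkhs_fun f -> rkhs_fun g -> rkhs_fun h ->
    rkhs_inner (fun x => a * f x + g x) h = a * rkhs_inner f h + rkhs_inner g h ;
  rkhs_inner_ge0 : forall f, rkhs_fun f -> 0 <= rkhs_inner f f ;
  rkhs_inner_eq0 : forall f, rkhs_fun f -> rkhs_inner f f = 0 -> f = cst 0 ;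
  rkhs_complete : forall u : nat -> T -> R, (forall n, rkhs_fun (u n)) ->
    (forall e : R, 0 < e -> exists N : nat, forall m n, (N <= m)%N -> (N <= n)%N ->
       Num.sqrt (rkhs_inner (u m \- u n) (u m \- u n)) < e) ->
    exists2 f, rkhs_fun f &
      forall e : R, 0 < e -> exists N : nat, forall n, (N <= n)%N ->
        Num.sqrt (rkhs_inner (u n \- f) (u n \- f)) < e ;
  rkhs_kernel : forall z, rkhs_fun (k z) ;
  rkhs_reproducing : forall z h, rkhs_fun h -> rkhs_inner h (k z) = h z
}.

Definition rkhs_norm k (H : rkhs k) h : R := Num.sqrt (rkhs_inner H h h).

End kernels.

Definition argmin (F : Type) (R : realType) (J : F -> \bar R) : set F :=
  [set f0 | forall f, (J f0 <= J f)%E].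

Section empirical_distribution.
Context d (T : measurableType d) (R : realType).
Variables (n : nat) (z : 'I_n -> T).

Definition empirical (A : set T) : \bar R :=
  (n%:R^-1%:E * \sum_(i < n) \d_(z i) A)%E.

Let empirical0 : empirical set0 = 0%E.
Proof. by rewrite /empirical big1 ?mule0// => i _; rewrite measure0. Qed.

Let empirical_ge0 A : (0 <= empirical A)%E.
Proof. by rewrite mule_ge0 ?lee_fin ?invr_ge0// sume_ge0. Qed.

Let atom (i : nat) : {measure set T -> \bar R} :=
  if insub i is Some j then dirac (z j) else mzero.

Let empirical_sigma_additive : semi_sigma_additive empirical.
Proof.
have n1_ge0 : 0 <= (n%:R^-1 : R) by rewrite invr_ge0.
rewrite (_ : empirical = mscale (NngNum n1_ge0) (msum atom n)).
  exact: measure_semi_sigma_additive.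
apply/funext => A; rewrite /empirical /mscale /msum /=; congr (_ * _)%E.
by apply: eq_bigr => i _; rewrite /atom valK.
Qed.

HB.instance Definition _ := isMeasure.Build _ _ _ empirical
  empirical0 empirical_ge0 empirical_sigma_additive.

Lemma empirical_setT : (0 < n)%N -> empirical [set: T] = 1%E.
Proof.
move=> n0; rewrite /empirical (eq_bigr (fun=> 1%E)); last first.
  by move=> i _; rewrite diracT.
by rewrite sumEFin -EFinM sumr_const card_ord mulVf// pnatr_eq0 -lt0n.
Qed.

End empirical_distribution.

Section samples.
Context d d' (Omega : measurableType d) (T : measurableType d') (R : realType).
Variables (mu : probability Omega R) (n : nat) (X : 'I_n -> {RV mu >-> T}).

Definition mutually_independent : Prop :=
  forall (J : {set 'I_n}) (A : 'I_n -> set T),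
    (forall i, measurable (A i)) ->
    mu [set omega | forall i, i \in J -> A i (X i omega)] =
    (\prod_(i in J) mu (X i @^-1` A i))%E.

Definition iid_sample (P : probability T R) : Prop :=
  mutually_independent /\
  (forall i A, measurable A -> distribution mu (X i) A = P A).

End samples.

Section mmd_dro.
Context d (T : measurableType d) (R : realType).
Implicit Types (Q : probability T R) (g : T -> R).

(* The expectation of [g] exists in the extended reals: its positive and
   negative parts do not both have an infinite integral. *)
Definition expectation_defined Q g : Prop :=
  measurable_fun [set: T] g /\
  ((\int[Q]_z (g^\+ z)%:E < +oo)%E \/ (\int[Q]_z (g^\- z)%:E < +oo)%E).

Variables (k : T -> T -> R) (H : rkhs k).

Definition mmd (Q1 Q2 : {measure set T -> \bar R}) : \bar R :=
  ereal_sup [set (\int[Q1]_z (h z)%:E - \int[Q2]_z (h z)%:E)%E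
            | h in [set h | rkhs_fun H h /\ rkhs_norm H h <= 1]].

Definition mmd_ball (P0 : {measure set T -> \bar R}) (eta : R) :
    set (probability T R) :=
  [set Q | (mmd Q P0 <= eta%:E)%E].

Definition worst_case_risk (P0 : {measure set T -> \bar R}) (eta : R) g :
    \bar R :=
  ereal_sup [set 'E_Q[g]%E | Q in mmd_ball P0 eta].

End mmd_dro.

(* Main.v *)
Require Import Defs.
From HB Require Import structures.
From mathcomp Require Import all_boot all_order all_algebra.
From mathcomp Require Import all_classical all_reals all_analysis.
From mathcomp Require Import measurable_realfun ring lra.

Set Implicit Arguments.
Unset Strict Implicit.
Unset Printing Implicit Defensive.

Import Order.TTheory GRing.Theory Num.Theory.
Import numFieldNormedType.Exports.

Local Open Scope classical_set_scope.
Local Open Scope ring_scope.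

(** The theorem has a deterministic half and a probabilistic half.

    Deterministic half ([worst_case_risk_le]).  If the true distribution [P]
    lies in the MMD ball of radius [eta] around the empirical distribution,
    then the risk of the DRO solution is at most its worst-case risk, hence at
    most the worst-case risk of [fstar].  As [l fstar] belongs to the RKHS and
    has norm at most [M], its expectations under two distributions of the ball
    differ by at most [2 * M * eta], by the triangle inequality through the
    empirical distribution.

    Probabilistic half ([mmd_empirical_tail]).  With probability at least
    [1 - delta], [P] does lie in that ball.  The MMD between [P] and the
    empirical distribution is the Hilbert norm of a centred empirical mean of
    the feature vectors [k z].  It changes by at most [2 * K / n] when one
    sample changes, and its mean is at most [K / sqrt n] since the variances of
    independent centred vectors add up; McDiarmid's inequality
    ([mcdiarmid], [hilbert_hoeffding]), based on Hoeffding's lemma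
    ([hoeffding_mgf]), gives the deviation term with the sharp constant.

    All of this concentration argument takes place in finite probability
    spaces: by compactness and continuity of [k], the sample space splits into
    finitely many Borel cells on each of which the feature map oscillates by
    less than [e] ([finite_discretisation]), and replacing each point by the
    centre of its cell changes the MMD by at most [2 * e]
    ([mmd_discretised]).  Expectations over the samples become weighted sums
    over tuples of cells, for which McDiarmid's inequality is an induction on
    the length, and the feature vectors live in a finite-dimensional space
    with the Gram form of the centres.  Letting [e] tend to [0] costs nothing
    in the probability, because an event all of whose points eventually belong
    to sets of measure at most [delta] has measure at most [delta]
    ([measure_eventually_le]). *)

(** * Hoeffding's lemma and McDiarmid's inequality on finite spaces *)

Section hoeffding_lemma.
Context {R : realType}.

Lemma is_derive_ge0_le (f df : R -> R) :
  (forall x, is_derive x (1 : R) f (df x)) -> (forall x, 0 <= x -> 0 <= df x) ->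
  forall u, 0 <= u -> f 0 <= f u.
Proof.
move=> fdf df_ge0 u u_ge0.
have [|c /[!in_itv]/= /andP[c_ge0 _] fuE] := MVT_segment u_ge0 (fun x _ => fdf x).
  apply: continuous_subspaceT => x.
  by apply/differentiable_continuous/derivable1_diffP; have [] := fdf x.
by rewrite -subr_ge0 fuE subr0 mulr_ge0// df_ge0.
Qed.

(** The moment generating function of a Bernoulli variable of parameter [q].
    The derivative of the quotient of the left-hand side by the right-hand side
    has the sign of [- g], where [g] is defined below; and [g] vanishes at [0]
    and is nondecreasing because [y * (1 - y) <= 1 / 4] for
    [y = q * expR x / D x]. *)
Lemma hoeffding_bernoulli (q u : R) : 0 <= q <= 1 -> 0 <= u ->
  1 - q + q * expR u <= expR (q * u + u ^+ 2 / 8).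
Proof.
move=> /andP[q_ge0 q_le1] u_ge0.
pose D x : R := 1 - q + q * expR x.
have D_gt0 x : 0 < D x.
  rewrite /D; have := expR_gt0 x; have [->|q0] := eqVneq q 0; first by lra.
  by move=> e0; rewrite ltr_wpDl ?subr_ge0// mulr_gt0// lt_neqAle eq_sym q0.
have DD x : is_derive x (1 : R) D (q * expR x).
  by apply: is_derive_eq; rewrite /GRing.scale/=; ring.
have D_neq0 x : D x != 0 by rewrite gt_eqF.
pose g x : R := q + x / 4 - q * expR x / D x.
have g_ge0 x : 0 <= x -> 0 <= g x.
  have g0 : g 0 = 0.
    by rewrite /g /D expR0 mul0r addr0 mulr1 subrK divr1 subrr.
  rewrite -[X in _ -> X <= _]g0.
  apply: (@is_derive_ge0_le _ (fun x => 4^-1 - q * expR x * (1 - q) / D x ^+ 2)).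
    move=> y; rewrite /g.
    have := is_deriveV (D_neq0 y) (DD y).
    move=> DV; apply: is_derive_eq.
    rewrite /GRing.scale/= /D; field; exact: D_neq0.
  move=> y _; rewrite subr_ge0 ler_pdivrMr ?exprn_gt0// /D.
  have := sqr_ge0 (1 - q - q * expR y); nra.
pose f x : R := - (D x * expR (- (q * x + x ^+ 2 / 8))).
suff : f 0 <= f u.
  rewrite /f /D expR0 mulr0 expr0n/= mul0r addr0 oppr0 expR0 !mulr1 subrK.
  by rewrite lerN2 expRN ler_pdivrMr ?expR_gt0// mul1r.
move: u_ge0; apply: (@is_derive_ge0_le _
  (fun x => D x * expR (- (q * x + x ^+ 2 / 8)) * g x)).
  move=> y; rewrite /f.
  apply: is_derive_eq.
  rewrite /g /GRing.scale/=; field; exact: D_neq0.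
by move=> y y0; rewrite !mulr_ge0 ?g_ge0 ?expR_ge0// ltW.
Qed.
End hoeffding_lemma.

Section finite_mean.
Context {R : realType} {A : finType}.
Variable p : A -> R.
Hypotheses (p_ge0 : forall a, 0 <= p a) (p_sum1 : \sum_a p a = 1).

(** Hoeffding's lemma.  Convexity of the exponential bounds [expR (s * y a)] by
    its chord over the range of [y], which reduces the claim to a two-point
    distribution. *)
Lemma hoeffding_mgf (y : A -> R) (c s : R) : 0 <= s ->
  (forall a b, y a - y b <= c) ->
  \sum_a p a * expR (s * y a) <= expR (s * \sum_a p a * y a + s ^+ 2 * c ^+ 2 / 8).
Proof.
move=> s_ge0 yc.
have [a0 _|A0] := pickP [pred _ : A | true]; last first.
  by move: p_sum1; rewrite big_pred0 // => /eqP; rewrite eq_sym oner_eq0.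
have [m _ ym] := @Order.TotalTheory.arg_minP _ _ A a0 predT y isT.
have c_ge0 : 0 <= c by have := yc a0 a0; rewrite subrr.
have y_m a : y m <= y a <= y m + c.
  by have := ym a isT; have := yc a m => ? ->/=; rewrite addrC -lerBlDr.
set ybar := \sum_a p a * y a.
have [c0|c_neq0] := eqVneq c 0.
  have yE a : y a = y m.
    by apply/eqP; rewrite eq_le andbC; have := y_m a; rewrite c0 addr0.
  have -> : ybar = y m.
    by rewrite /ybar (eq_bigr (fun a => p a * y m)) -?mulr_suml ?p_sum1 ?mul1r// =>
      a _; rewrite yE.
  rewrite (eq_bigr (fun a => p a * expR (s * y m))) => [|a _]; last by rewrite yE.
  by rewrite -mulr_suml p_sum1 mul1r c0 expr0n/= mulr0 mul0r addr0.
have c_gt0 : 0 < c by rewrite lt_neqAle eq_sym c_neq0.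
(* the position of [y a] in [[y m, y m + c]] *)
pose t a := (y a - y m) / c.
have t01 a : 0 <= t a <= 1.
  have /andP[y1 y2] := y_m a.
  rewrite /t divr_ge0 ?subr_ge0//= ler_pdivrMr// mul1r.
  by rewrite lerBlDl.
pose q := (ybar - y m) / c.
have tbar : \sum_a p a * t a = q.
  rewrite /q /ybar -[in RHS](mul1r (y m)) -p_sum1 !mulr_suml -sumrB mulr_suml.
  by apply: eq_bigr => a _; rewrite /t; ring.
have chord a : expR (s * y a) <= expR (s * y m) * (1 - t a + t a * expR (s * c)).
  have /andP[t0 t1] := t01 a.
  have := @convex_expR R (Itv01 t0 t1) (s * (y m + c)) (s * y m).
  rewrite !convRE /unstable.onem/= => H.
  have -> : s * y a = t a * (s * (y m + c)) + (1 - t a) * (s * y m).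
    rewrite /t; field; exact: c_neq0.
  by apply: (le_trans H); rewrite [in leLHS]mulrDr [in leLHS]expRD le_eqVlt;
    apply/orP/or_introl/eqP; ring.
apply: (@le_trans _ _ (expR (s * y m) *
    (1 - q + q * expR (s * c)))).
  rewrite -tbar -[X in X - _]p_sum1 -sumrB mulr_suml -big_split/= mulr_sumr.
  apply: ler_sum => a _; apply: le_trans (ler_wpM2l (p_ge0 a) (chord a)) _.
  by rewrite le_eqVlt; apply/orP/or_introl/eqP; ring.
apply: (@le_trans _ _ (expR (s * y m) *
    expR (q * (s * c) + (s * c) ^+ 2 / 8))).
  rewrite ler_wpM2l ?expR_ge0//; apply: hoeffding_bernoulli; last by rewrite mulr_ge0.
  rewrite -tbar.
  rewrite sumr_ge0 => [|a _]; last by rewrite mulr_ge0//; case/andP: (t01 a).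
  rewrite -[leRHS]p_sum1; apply: ler_sum => a _.
  by rewrite -[leRHS]mulr1 ler_wpM2l//; case/andP: (t01 a).
rewrite -expRD ler_expR le_eqVlt; apply/orP/or_introl/eqP.
by rewrite /q; field.
Qed.

(** The expectation of [g] over [n] independent samples of law [p].  The
    statistic [g] is defined on sequences of any length, so that fixing the
    first sample turns a statistic of [n.+1] samples into one of [n]. *)
Definition iid_mean n (g : seq A -> R) : R :=
  \sum_(t : n.-tuple A) (\prod_(a <- t) p a) * g t.

Lemma iid_mean0 g : iid_mean 0 g = g [::].
Proof.
rewrite /iid_mean (big_pred1 [tuple]) => [|t]; first by rewrite big_nil mul1r.
by apply/esym/eqP/tuple0.
Qed.

Lemma iid_meanS n g :
  iid_mean n.+1 g = \sum_a p a * iid_mean n (fun s => g (a :: s)).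
Proof.
rewrite /iid_mean.
under [RHS]eq_bigr do rewrite mulr_sumr.
rewrite pair_bigA/=.
rewrite (reindex (fun x : A * n.-tuple A => [tuple of x.1 :: x.2]))/=.
  by apply: eq_bigr => x _; rewrite big_cons mulrA.
exists (fun t : n.+1.-tuple A => (thead t, [tuple of behead t])) => [[a t] _|t _].
  by congr pair; apply: val_inj.
by case/tupleP: t => a t; apply: val_inj; rewrite /= theadE.
Qed.

Lemma le_iid_mean n g h : (forall s, g s <= h s) -> iid_mean n g <= iid_mean n h.
Proof.
by move=> gh; apply: ler_sum => t _; rewrite ler_wpM2l// prodr_ge0.
Qed.

Lemma iid_mean_cst n (c : R) : iid_mean n (fun=> c) = c.
Proof.
elim: n => [|n IHn]; first exact: iid_mean0.
by rewrite iid_meanS; under eq_bigr do rewrite IHn; rewrite -mulr_suml p_sum1 mul1r.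
Qed.

Lemma iid_meanD n g h :
  iid_mean n (fun s => g s + h s) = iid_mean n g + iid_mean n h.
Proof. by rewrite -big_split/=; apply: eq_bigr => t _; rewrite mulrDr. Qed.

Lemma iid_meanZ n (c : R) g : iid_mean n (fun s => c * g s) = c * iid_mean n g.
Proof. by rewrite mulr_sumr; apply: eq_bigr => t _; rewrite mulrCA. Qed.

(** The martingale argument behind McDiarmid's inequality: condition on the
    first sample, apply the induction hypothesis to the remaining ones, and
    then Hoeffding's lemma to the conditional mean as a function of the first
    sample. *)
Lemma bounded_differences_mgf n (g : seq A -> R) (c s : R) : 0 <= s ->
  (forall s1 a b s2, g (s1 ++ a :: s2) - g (s1 ++ b :: s2) <= c) ->
  iid_mean n (fun t => expR (s * g t)) <=
  expR (s * iid_mean n g + n%:R * (s ^+ 2 * c ^+ 2 / 8)).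
Proof.
move=> s_ge0; elim: n g => [|n IHn] g gc.
  by rewrite !iid_mean0 mul0r addr0.
rewrite !iid_meanS.
set v := s ^+ 2 * c ^+ 2 / 8.
apply: (@le_trans _ _ (\sum_a p a *
    expR (s * iid_mean n (fun t => g (a :: t))) * expR (n%:R * v))).
  apply: ler_sum => a _; rewrite -mulrA -expRD ler_wpM2l//.
  by apply: IHn => s1 a1 b1 s2; rewrite -!cat_cons gc.
rewrite -mulr_suml -natr1 [in leRHS]mulrDl mul1r addrCA [leRHS]expRD [leRHS]mulrC.
rewrite [in leRHS]addrC ler_wpM2r ?expR_ge0//.
rewrite [leRHS](_ : _ = expR
  (s * (\sum_a p a * iid_mean n (fun t => g (a :: t))) + v)); last first.
  by congr expR; rewrite addrC.
apply: hoeffding_mgf => // a b.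
rewrite -mulN1r -iid_meanZ -iid_meanD -[leRHS](iid_mean_cst n).
by apply: le_iid_mean => t; rewrite mulN1r (gc [::]).
Qed.

Theorem mcdiarmid n (g : seq A -> R) (c tau : R) :
  (0 < n)%N -> 0 < c -> 0 <= tau ->
  (forall s1 a b s2, g (s1 ++ a :: s2) - g (s1 ++ b :: s2) <= c) ->
  \sum_(t : n.-tuple A | iid_mean n g + tau < g t) \prod_(a <- t) p a <=
  expR (- (2 * tau ^+ 2 / (n%:R * c ^+ 2))).
Proof.
move=> n_gt0 c_gt0 tau_ge0 gc.
have n_gt0' : 0 < n%:R :> R by rewrite ltr0n.
(* the exponent that minimises the Chernoff bound *)
pose s := 4 * tau / (n%:R * c ^+ 2).
have s_ge0 : 0 <= s.
  by rewrite /s divr_ge0 ?mulr_ge0 ?exprn_ge0 ?ler0n// ltW.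
set m := iid_mean n g.
apply: (@le_trans _ _ (expR (- (s * (m + tau))) *
    iid_mean n (fun t => expR (s * g t)))).
  rewrite mulr_sumr big_mkcond/=; apply: ler_sum => t _.
  have p_t : 0 <= \prod_(a <- t) p a by rewrite prodr_ge0.
  case: ifPn => [gt_m|_]; last by rewrite !mulr_ge0 ?expR_ge0.
  rewrite mulrCA -expRD -[leLHS]mulr1 ler_wpM2l// -expR0 ler_expR.
  by rewrite addrC -mulrBr mulr_ge0// subr_ge0 ltW.
apply: (le_trans (ler_wpM2l (expR_ge0 _) (bounded_differences_mgf n s_ge0 gc))).
rewrite -expRD ler_expR -/m le_eqVlt; apply/orP/or_introl/eqP.
by rewrite /s; field; rewrite gt_eqF// gt_eqF.
Qed.

End finite_mean.

(** * Concentration of sums in a semi-inner product space *)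

Lemma discriminant_le0 (R : realType) (a b c : R) : 0 <= a -> 0 <= c ->
  (forall t, 0 <= a * t ^+ 2 + 2 * b * t + c) -> b ^+ 2 <= a * c.
Proof.
move=> a_ge0 c_ge0 q_ge0; have [a0|a_neq0] := eqVneq a 0.
  have [->|b_neq0] := eqVneq b 0; first by rewrite expr0n/= mulr_ge0.
  (* a value of [t] at which the affine function equals [-1] *)
  have := q_ge0 (- (c + 1) / (2 * b)).
  have -> : a * (- (c + 1) / (2 * b)) ^+ 2 + 2 * b * (- (c + 1) / (2 * b)) + c = - 1.
    by rewrite a0; field.
  by rewrite ler0N1.
have a_gt0 : 0 < a by rewrite lt_neqAle eq_sym a_neq0.
(* the minimiser of the quadratic function *)
have := q_ge0 (- b / a).
have -> : a * (- b / a) ^+ 2 + 2 * b * (- b / a) + c = (a * c - b ^+ 2) / a.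
  by field.
by rewrite pmulr_lge0 ?invr_gt0// subr_ge0.
Qed.

Section semi_inner_product.
Context {R : realType} {V : lmodType R}.
Variable B : V -> V -> R.
Hypotheses (BC : forall u v, B u v = B v u)
  (BDl : forall a u v w, B (a *: u + v) w = a * B u w + B v w)
  (B_ge0 : forall u, 0 <= B u u).

(** The seminorm of the positive semidefinite bilinear form [B].  The form may
    be degenerate, as the Gram form of repeated points is. *)
Definition seminorm u := Num.sqrt (B u u).
Local Notation N := seminorm.

Let B0l w : B 0 w = 0.
Proof.
have := BDl 1 0 0 w; rewrite scaler0 addr0 mul1r => /eqP.
by rewrite -subr_eq0 opprD addrA subrr sub0r oppr_eq0 => /eqP.
Qed.

Let BDr a u v w : B w (a *: u + v) = a * B w u + B w v.
Proof. by rewrite BC BDl BC (BC v). Qed.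

Let B0r w : B w 0 = 0. Proof. by rewrite BC B0l. Qed.

Let B_sumr (I : finType) (a : I -> R) (v : I -> V) w :
  B w (\sum_i a i *: v i) = \sum_i a i * B w (v i).
Proof.
by elim/big_rec2 : _ => [|i y1 y2 _ <-]; [exact: B0r|rewrite BDr].
Qed.

Let B_sqrD a u v : B (a *: u + v) (a *: u + v) =
  B u u * a ^+ 2 + 2 * B u v * a + B v v.
Proof. by rewrite BDl !BDr (BC v u); ring. Qed.

Lemma seminorm_ge0 u : 0 <= N u. Proof. exact: sqrtr_ge0. Qed.

Lemma seminorm_sqr u : N u ^+ 2 = B u u. Proof. by rewrite sqr_sqrtr. Qed.

Lemma cauchy_schwarz_seminorm u v : B u v <= N u * N v.
Proof.
have := @discriminant_le0 _ (B u u) (B u v) (B v v) (B_ge0 u) (B_ge0 v).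
move=> /(_ (fun t => _)) CS.
rewrite (le_trans (ler_norm _))// -ler_sqr ?nnegrE ?mulr_ge0 ?seminorm_ge0//.
rewrite exprMn !seminorm_sqr real_normK ?num_real//; apply: CS => t.
by rewrite -B_sqrD.
Qed.

Lemma ler_seminormD u v : N (u + v) <= N u + N v.
Proof.
rewrite -ler_sqr ?nnegrE ?addr_ge0 ?seminorm_ge0// sqrrD !seminorm_sqr.
rewrite -[u in X in X <= _]scale1r B_sqrD.
have := cauchy_schwarz_seminorm u v; lra.
Qed.

Lemma seminormZ a u : N (a *: u) = `|a| * N u.
Proof.
rewrite /seminorm (_ : B (a *: u) (a *: u) = a ^+ 2 * B u u); last first.
  by rewrite -[a *: u]addr0 B_sqrD !B0r mulr0 mul0r !addr0 mulrC.
by rewrite sqrtrM ?sqr_ge0// sqrtr_sqr.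
Qed.

(** The feature vectors [X a] have seminorm at most [K], and [Y a] is the centred
    vector. *)
Section concentration.
Context {A : finType}.
Variables (p : A -> R) (X : A -> V) (K : R).
Hypotheses (p_ge0 : forall a, 0 <= p a) (p_sum1 : \sum_a p a = 1).
Hypotheses (K_gt0 : 0 < K) (X_le_K : forall a, N (X a) <= K).

Let mean := \sum_a p a *: X a.
Let Y a := X a - mean.
Let S t := \sum_(a <- t) Y a.

Let mean_Y : \sum_a p a *: Y a = 0.
Proof.
rewrite /Y; under eq_bigr do rewrite scalerBr.
by rewrite sumrB -scaler_suml p_sum1 scale1r subrr.
Qed.

Let variance_Y : \sum_a p a * B (Y a) (Y a) <= K ^+ 2.
Proof.
have YE a : B (Y a) (Y a) = B (X a) (X a) - 2 * B mean (X a) + B mean mean.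
  by rewrite /Y addrC -scaleN1r B_sqrD; ring.
under eq_bigr do rewrite YE mulrDr mulrBr mulrCA.
rewrite big_split/= sumrB -mulr_suml p_sum1 -mulr_sumr -B_sumr -/mean.
have : \sum_a p a * B (X a) (X a) <= K ^+ 2.
  rewrite -[leRHS]mul1r -p_sum1 mulr_suml; apply: ler_sum => a _.
  by rewrite ler_wpM2l// -seminorm_sqr ler_sqr ?nnegrE ?seminorm_ge0// ltW.
have := B_ge0 mean; lra.
Qed.

(** The cross terms vanish since [Y] is centred.  The offset [u], which stands
    for the partial sum of the samples already drawn, makes the statement
    inductive. *)
Let second_moment n u : iid_mean p n (fun t => B (u + S t) (u + S t)) =
  B u u + n%:R * \sum_a p a * B (Y a) (Y a).
Proof.
elim: n u => [|n IHn] u; first by rewrite iid_mean0 /S big_nil !addr0 mul0r addr0.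
rewrite iid_meanS.
under eq_bigr => a _.
  rewrite (_ : (fun s => _) = (fun s => B (u + Y a + S s) (u + Y a + S s))).
    rewrite IHn (_ : B (u + Y a) (u + Y a) = B u u + 2 * B u (Y a) + B (Y a) (Y a)).
      over.
    by rewrite addrC -[Y a]scale1r B_sqrD scale1r (BC (Y a)); ring.
  by apply/funext => s; rewrite /S big_cons addrA.
under eq_bigr do rewrite mulrDr mulrDr mulrDr.
rewrite !big_split/= -!mulr_suml p_sum1 !mul1r.
under [X in _ + X + _ + _]eq_bigr do rewrite mulrCA.
rewrite -mulr_sumr -B_sumr mean_Y B0r mulr0 addr0 -addrA -natr1; congr (_ + _).
by ring.
Qed.

Let mean_seminorm n : (0 < n)%N ->
  iid_mean p n (fun t => N (S t)) <= K * Num.sqrt n%:R.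
Proof.
(* Jensen's inequality for the square, through the bound
   [x <= x ^+ 2 / (2 * y) + y / 2] with [y = K * sqrt n]. *)
move=> n_gt0; set r := Num.sqrt n%:R.
have r_gt0 : 0 < r by rewrite sqrtr_gt0 ltr0n.
have Kr_gt0 : 0 < K * r by rewrite mulr_gt0.
apply: (@le_trans _ _ (iid_mean p n
    (fun t => (2 * (K * r))^-1 * B (0 + S t) (0 + S t) + K * r / 2))).
  apply: le_iid_mean => // t; rewrite add0r -seminorm_sqr -subr_ge0.
  rewrite (_ : _ - _ = (2 * (K * r))^-1 * (N (S t) - K * r) ^+ 2); last first.
    by field; rewrite !gt_eqF.
  by rewrite mulr_ge0 ?sqr_ge0// invr_ge0 mulr_ge0// ltW.
rewrite iid_meanD (iid_meanZ _ _ _ (fun t => B (0 + S t) (0 + S t))).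
rewrite iid_mean_cst// second_moment B0l add0r.
rewrite -lerBrDr ler_pdivrMl ?mulr_gt0//.
rewrite [leRHS](_ : _ = r ^+ 2 * K ^+ 2); last by field.
by rewrite sqr_sqrtr// ler_wpM2l.
Qed.

(** McDiarmid's inequality for the seminorm of the centred sum of [n] independent
    vectors of seminorm at most [K]: its mean is at most [K * sqrt n], and
    replacing one sample changes it by at most [2 * K]. *)
Theorem hilbert_hoeffding n (L : R) : (0 < n)%N -> 0 <= L ->
  \sum_(t : n.-tuple A | K * Num.sqrt n%:R * (1 + Num.sqrt (2 * L)) <
      N (\sum_(a <- t) (X a - mean))) \prod_(a <- t) p a <= expR (- L).
Proof.
move=> n_gt0 L_ge0.
set r := Num.sqrt n%:R; have r_gt0 : 0 < r by rewrite sqrtr_gt0 ltr0n.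
have tau_ge0 : 0 <= K * r * Num.sqrt (2 * L).
  by rewrite mulr_ge0 ?sqrtr_ge0// mulr_ge0// ltW.
have S_diff s1 a b s2 : N (S (s1 ++ a :: s2)) - N (S (s1 ++ b :: s2)) <= 2 * K.
  rewrite lerBlDl.
  have -> : S (s1 ++ a :: s2) = S (s1 ++ b :: s2) + (X a + (-1) *: X b).
    rewrite /S !big_cat !big_cons/= /Y scaleN1r -[RHS]addrA; congr (_ + _).
    by rewrite [RHS]addrC [RHS]addrA subrKA.
  apply: (le_trans (ler_seminormD _ _)); rewrite lerD2l.
  apply: (le_trans (ler_seminormD _ _)); rewrite seminormZ normrN1 mul1r.
  by rewrite mulr_natl mulr2n lerD.
have c_gt0 : 0 < 2 * K by rewrite mulr_gt0.
have := @mcdiarmid _ _ _ p_ge0 p_sum1 _ (fun t => N (S t)) _ _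
  n_gt0 c_gt0 tau_ge0 S_diff.
rewrite (_ : 2 * _ ^+ 2 / _ = L); last first.
  rewrite !exprMn sqr_sqrtr ?ler0n// sqr_sqrtr ?mulr_ge0//.
  by field; rewrite gt_eqF//= pnatr_eq0 -lt0n n_gt0.
apply: le_trans; rewrite big_mkcond [leRHS]big_mkcond/=; apply: ler_sum => t _.
case: ifPn => [lt_S|_]; last by case: ifP => // _; rewrite prodr_ge0.
rewrite ifT//; apply: le_lt_trans lt_S.
by rewrite mulrDr mulr1 lerD2r mean_seminorm.
Qed.

End concentration.
End semi_inner_product.

(** * Functions of a reproducing kernel Hilbert space *)

Section rkhs_theory.
Context {R : realType} {T : Type} {k : T -> T -> R} (H : rkhs k).
Implicit Types (f g h : T -> R).

Lemma rkhs_norm_ge0 h : 0 <= rkhs_norm H h. Proof. exact: sqrtr_ge0. Qed.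

Lemma rkhs_norm_sqr h : rkhs_fun H h -> rkhs_norm H h ^+ 2 = rkhs_inner H h h.
Proof. by move=> Hh; rewrite sqr_sqrtr// rkhs_inner_ge0. Qed.

Lemma rkhs_inner0l h : rkhs_fun H h -> rkhs_inner H (cst 0) h = 0.
Proof.
move=> Hh; have H0 := rkhs_fun0 H.
have := rkhs_innerDl (-1) H0 H0 Hh.
rewrite (_ : (fun x => _) = cst 0); last first.
  by apply/funext => x /=; rewrite mulr0 addr0.
by rewrite mulN1r addNr.
Qed.

Lemma rkhs_cauchy_schwarz f g : rkhs_fun H f -> rkhs_fun H g ->
  `|rkhs_inner H f g| <= rkhs_norm H f * rkhs_norm H g.
Proof.
move=> Hf Hg; rewrite -ler_sqr ?nnegrE ?mulr_ge0 ?rkhs_norm_ge0//.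
rewrite exprMn !rkhs_norm_sqr// real_normK ?num_real//.
apply: discriminant_le0 => [||t]; [exact: rkhs_inner_ge0|exact: rkhs_inner_ge0|].
have Hfg := rkhs_linear t Hf Hg.
have := rkhs_inner_ge0 Hfg; rewrite rkhs_innerDl//.
rewrite (rkhs_innerC Hf Hfg) (rkhs_innerC Hg Hfg) !rkhs_innerDl//.
by rewrite (rkhs_innerC Hg Hf); congr (0 <= _); ring.
Qed.

Section point_combination.
Context {I : Type} (s : seq I) (a : I -> R) (z : I -> T).
Let w := fun x => \sum_(i <- s) a i * k (z i) x.

Let w_fun_inner h : rkhs_fun H h ->
  rkhs_fun H w /\ rkhs_inner H w h = \sum_(i <- s) a i * h (z i).
Proof.
rewrite /w => Hh; elim: s => [|i t [Ht IHt]].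
  rewrite big_nil (_ : (fun x => _) = cst 0); last by apply/funext => x; rewrite big_nil.
  by split; [exact: rkhs_fun0|exact: rkhs_inner0l].
rewrite (_ : (fun x => _) =
    fun x => a i * k (z i) x + \sum_(j <- t) a j * k (z j) x); last first.
  by apply/funext => x; rewrite big_cons.
have Hk := rkhs_kernel H (z i); split; first exact: rkhs_linear.
rewrite (rkhs_innerDl (a i) Hk Ht Hh) IHt big_cons; congr (_ * _ + _).
by rewrite (rkhs_innerC Hk Hh) rkhs_reproducing.
Qed.

(** The reproducing property turns a combination of point evaluations into the
    inner product with the same combination of kernel functions, whose squared
    norm is the Gram sum. *)
Lemma rkhs_point_combination h : rkhs_fun H h ->
  `|\sum_(i <- s) a i * h (z i)| <=
  rkhs_norm H h *
  Num.sqrt (\sum_(i <- s) \sum_(j <- s) a i * a j * k (z i) (z j)).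
Proof.
move=> Hh; have [Hw wh] := w_fun_inner Hh; have [_ ww] := w_fun_inner Hw.
rewrite -wh mulrC; apply: (le_trans (rkhs_cauchy_schwarz Hw Hh)).
rewrite ler_wpM2r ?rkhs_norm_ge0// /rkhs_norm ww /w le_eqVlt; apply/orP/or_introl.
apply/eqP; congr Num.sqrt; rewrite exchange_big/=; apply: eq_bigr => i _.
by rewrite mulr_sumr; apply: eq_bigr => j _; rewrite mulrA (mulrC (a i)).
Qed.
End point_combination.

Lemma rkhs_le_norm h x : rkhs_fun H h ->
  `|h x| <= rkhs_norm H h * Num.sqrt (k x x).
Proof.
move=> Hh.
have := @rkhs_point_combination unit [:: tt] (fun=> 1) (fun=> x) h Hh.
by rewrite !big_seq1 !mul1r.
Qed.

(** The squared distance of the feature vectors [k x] and [k y]. *)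
Definition kernel_dist2 x y := k x x - 2 * k x y + k y y.

Lemma rkhs_le_dist h x y : rkhs_fun H h ->
  `|h x - h y| <= rkhs_norm H h * Num.sqrt (kernel_dist2 x y).
Proof.
move=> Hh.
have := @rkhs_point_combination bool [:: true; false]
  (fun b => if b then 1 else -1) (fun b => if b then x else y) h Hh.
rewrite !big_cons !big_nil !addr0 /= mul1r mulN1r.
have kC : k y x = k x y.
  have [Hx Hy] := (rkhs_kernel H x, rkhs_kernel H y).
  by rewrite -(rkhs_reproducing x Hy) -(rkhs_reproducing y Hx) rkhs_innerC.
by congr (_ <= _ * Num.sqrt _); rewrite /kernel_dist2 kC; ring.
Qed.

Lemma rkhs_normZ a h : rkhs_fun H h ->
  rkhs_fun H (fun x => a * h x) /\
  rkhs_norm H (fun x => a * h x) = `|a| * rkhs_norm H h.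
Proof.
move=> Hh; have H0 := rkhs_fun0 H.
have E : (fun x => a * h x) = fun x => a * h x + cst 0 x.
  by apply/funext => x; rewrite addr0.
have Hah : rkhs_fun H (fun x => a * h x) by rewrite E; exact: rkhs_linear.
split=> //; rewrite /rkhs_norm -sqrtr_sqr -sqrtrM ?sqr_ge0//; congr Num.sqrt.
have inner_ah g : rkhs_fun H g ->
    rkhs_inner H (fun x => a * h x) g = a * rkhs_inner H h g.
  by move=> Hg; rewrite E rkhs_innerDl// rkhs_inner0l// addr0.
by rewrite inner_ah// rkhs_innerC// inner_ah// mulrA.
Qed.

End rkhs_theory.

(** * Continuity and finite discretisation *)

Lemma compact_set_type (X : topologicalType) (A : set X) :
  compact A -> compact [set: A].
Proof.
move=> cA F FF _.
have [|p [Ap clp]] := cA ((fun y : A => set_val y) @ F) _.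
  by rewrite nbhs_simpl/=; apply: filterS filterT => y _; exact: set_valP.
exists (exist _ p (mem_set Ap)); split=> // U V FU.
rewrite nbhsE => -[_ [[W oW <-] /= Wp] WV].
have [|y [[x Ux xy] Wy]] := clp (set_val @` U) W _ (open_nbhs_nbhs (conj oW Wp)).
  by rewrite nbhs_simpl/=; apply: filterS FU => x Ux; exists x.
by exists x; split => //; apply: WV; rewrite /= xy.
Qed.

Section continuous_kernel.
Context {R : realType} {T : topologicalType} {t0 : T}.
Context {k : borel t0 -> borel t0 -> R}.
Hypothesis k_continuous :
  continuous (fun p : borel t0 * borel t0 => k p.1 p.2).

Lemma continuous_kernel_dist2 c :
  continuous (fun x => kernel_dist2 (k := k) x c).
Proof.
have kdiag : continuous (fun x : borel t0 => k x x).
  move=> x; apply: (@continuous_comp _ _ _ (fun y : borel t0 => (y, y))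
    (fun p : borel t0 * borel t0 => k p.1 p.2)); last exact: k_continuous.
  by apply: cvg_pair; exact: cvg_id.
have kc : continuous (k ^~ c).
  move=> x; apply: (@continuous_comp _ _ _ (fun y : borel t0 => (y, c))
    (fun p : borel t0 * borel t0 => k p.1 p.2)); last exact: k_continuous.
  by apply: cvg_pair; [exact: cvg_id|exact: cvg_cst].
move=> x; rewrite /kernel_dist2.
apply: cvgD; last exact: cvg_cst.
apply: cvgB; first exact: kdiag.
by apply: cvgM; [exact: cvg_cst|exact: kc].
Qed.

Lemma continuous_borel_measurable (f : borel t0 -> R) :
  continuous f -> measurable_fun [set: borel t0] f.
Proof.
move=> /continuousP cf; apply: (measurability _ (RGenOpens.measurableE R)).
move=> _ [_ [a [b ->] <-]]; rewrite setTI; apply: sub_gen_smallest.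
by apply: cf; exact: interval_open.
Qed.

Lemma rkhs_continuous (H : rkhs k) h : rkhs_fun H h -> continuous h.
Proof.
move=> Hh c; apply/cvgrPdist_lt => e e_gt0.
have : (fun x => rkhs_norm H h * Num.sqrt (kernel_dist2 (k := k) x c)) @ nbhs c -->
    rkhs_norm H h * Num.sqrt (kernel_dist2 (k := k) c c).
  apply: cvgM; first exact: cvg_cst.
  apply: (@continuous_comp _ _ _ (fun x => kernel_dist2 (k := k) x c) Num.sqrt).
    exact: continuous_kernel_dist2.
  exact: sqrt_continuous.
rewrite (_ : kernel_dist2 (k := k) c c = 0); last by rewrite /kernel_dist2; ring.
rewrite sqrtr0 mulr0 => /cvgrPdist_lt /(_ e e_gt0); apply: filterS => x.
rewrite sub0r normrN => lt_e; rewrite distrC; apply: le_lt_trans lt_e.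
exact: le_trans (rkhs_le_dist _ _ Hh) (ler_norm _).
Qed.

End continuous_kernel.

Section finite_discretisation.
Context {R : realType} {T : topologicalType} {t0 : T}.
Context {k : borel t0 -> borel t0 -> R}.
Hypotheses (T_compact : compact [set: borel t0])
  (k_continuous : continuous (fun p : borel t0 * borel t0 => k p.1 p.2)).

Let ball2 (e : R) (c : borel t0) := [set x | kernel_dist2 (k := k) x c < e].

Let open_ball2 e c : open (ball2 e c).
Proof.
rewrite (_ : ball2 e c = (fun x => kernel_dist2 (k := k) x c) @^-1` `]-oo, e[%classic).
  apply: open_comp; last exact: interval_open.
  by move=> x _; exact: continuous_kernel_dist2.
by apply/seteqP; split => x; rewrite /ball2/= in_itv.
Qed.

Let measurable_find (e : R) (s : seq (borel t0)) j :
  measurable [set x | find (fun c => kernel_dist2 (k := k) x c < e) s = j].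
Proof.
elim: s j => [|c s IHs] j /=.
  have [<-|j0] := eqVneq 0%N j.
    by rewrite (_ : [set _ | _] = setT)//; apply/seteqP; split.
  rewrite (_ : [set _ | _] = set0)//; apply/seteqP; split => //= x j0E.
  by rewrite j0E eqxx in j0.
have mc : measurable (ball2 e c) by apply: sub_gen_smallest; exact: open_ball2.
case: j => [|j].
  rewrite (_ : [set _ | _] = ball2 e c)//.
  by apply/seteqP; split => x; rewrite /ball2/=; case: ifP.
rewrite (_ : [set _ | _] = ~` ball2 e c `&`
   [set x | find (fun c => kernel_dist2 (k := k) x c < e) s = j]).
  by apply: measurableI => //; exact: measurableC.
apply/seteqP; split => x; rewrite /ball2/=; case: ifP => xc.
- by [].
- by move=> [<-]; split.
- by case.
- by move=> [_ <-].
Qed.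

(** Finitely many balls of the kernel distance, which are open, cover the
    compact space.  The cell of [x] is indexed by the first ball that contains
    [x], and [c a] is the centre of the ball of index [a]. *)
Lemma finite_discretisation (e : R) : 0 < e ->
  exists N (c : 'I_N -> borel t0) (r : borel t0 -> 'I_N),
    (forall a, measurable (r @^-1` [set a])) /\
    (forall x, kernel_dist2 (k := k) x (c (r x)) < e).
Proof.
move=> e_gt0; move: T_compact; rewrite compact_cover.
move=> /(_ (borel t0) setT (ball2 e)) [||D _ D_cover].
- by move=> c _; exact: open_ball2.
- move=> x _; exists x => //=; rewrite /ball2/= /kernel_dist2.
  by rewrite (_ : _ + _ = 0)//; ring.
pose s : seq (borel t0) := finmap.enum_fset D.
pose P x c := kernel_dist2 (k := k) x c < e.
have s_cover x : has (P x) s.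
  by have [c cD xc] := D_cover x I; apply/hasP; exists c.
have find_lt x : (find (P x) s < size s)%N by rewrite -has_find.
exists (size s), (fun a => nth t0 s a), (fun x => Ordinal (find_lt x)); split.
  move=> a; have := measurable_find e s a; congr (measurable _).
  by apply/seteqP; split => x /= => [xa|/(congr1 val)//]; apply: val_inj.
by move=> x /=; have := nth_find t0 (s_cover x).
Qed.

End finite_discretisation.

Section discretised_integral.
Context d (T : measurableType d) (R : realType).
Variables (Q : {measure set T -> \bar R}) (Q1 : Q [set: T] = 1%E).
Variables (N : nat) (r : T -> 'I_N).
Hypothesis mr : forall a, measurable (r @^-1` [set a]).

Let Q_fin A : measurable A -> Q A \is a fin_num.
Proof.
move=> mA; rewrite ge0_fin_numE ?measure_ge0//.
by rewrite (@le_lt_trans _ _ 1%E) ?ltry// -Q1 le_measure ?inE.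
Qed.

Let comp_indic (g : 'I_N -> R) x :
  g (r x) = \sum_(a < N) g a * \1_(r @^-1` [set a]) x.
Proof.
rewrite (bigD1 (r x))//= big1 ?addr0 => [|a a_rx].
  by rewrite indicE mem_set ?mulr1.
by rewrite indicE memNset ?mulr0//= => rx; rewrite rx eqxx in a_rx.
Qed.

Lemma integrable_bounded (h : T -> R) (C : R) : measurable_fun setT h ->
  (forall x, `|h x| <= C) -> Q.-integrable setT (EFin \o h).
Proof.
move=> mh hC; apply: measurable_bounded_integrable => //.
  by rewrite [ltLHS]Q1 ltry.
exists C; split; first exact: num_real.
by move=> y Cy x _; apply: le_trans (hC x) _; exact: ltW.
Qed.

Let integrable_indic g a :
  Q.-integrable setT (fun x => (g a * \1_(r @^-1` [set a]) x)%:E).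
Proof.
apply: (@integrable_bounded (fun x => g a * \1_(r @^-1` [set a]) x) `|g a|).
  by apply: measurable_funM => //; exact: measurable_indic.
move=> x; rewrite normrM -[leRHS]mulr1 ler_wpM2l// indicE.
by case: (_ \in _); rewrite ?normr1 ?normr0.
Qed.

Lemma integral_finite_comp (g : 'I_N -> R) :
  Q.-integrable setT (fun x => (g (r x))%:E) /\
  \int[Q]_x g (r x) = \sum_(a < N) fine (Q (r @^-1` [set a])) * g a.
Proof.
have gE : (fun x => (g (r x))%:E) =
    fun x => (\sum_(a < N) (g a * \1_(r @^-1` [set a]) x)%:E)%E.
  by apply/funext => x; rewrite comp_indic sumEFin.
split; first by rewrite gE; apply: integrable_sum => // a _; exact: integrable_indic.
rewrite /Rintegral gE integral_sum//.
rewrite (eq_bigr (fun a => (fine (Q (r @^-1` [set a])) * g a)%:E)); last first.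
  move=> a _; under eq_integral do rewrite EFinM.
  rewrite integralZl//; last first.
    apply: (@integrable_bounded _ 1); first exact: measurable_indic.
    by move=> x; rewrite indicE; case: (_ \in _); rewrite ?normr1 ?normr0.
  by rewrite integral_indic// setIT EFinM fineK ?Q_fin// muleC.
by rewrite sumEFin.
Qed.

Lemma integral_discretised (h : T -> R) (g : 'I_N -> R) (e : R) :
  Q.-integrable setT (EFin \o h) -> (forall x, `|h x - g (r x)| <= e) ->
  `|\int[Q]_x h x - \sum_(a < N) fine (Q (r @^-1` [set a])) * g a| <= e.
Proof.
move=> ih hg; have [ig <-] := integral_finite_comp g.
rewrite -RintegralB//.
have ihg : Q.-integrable setT (EFin \o (fun x => h x - g (r x))).
  by rewrite (_ : EFin \o _ = fun x => ((h x)%:E - (g (r x))%:E)%E)//; exact: integrableB.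
apply: (le_trans (le_normr_Rintegral _ ihg)) => //.
have cstE : \int[Q]_(_ in setT) e = e.
  by rewrite Rintegral_cst// [Q _]Q1 mulr1.
rewrite -[leRHS]cstE; apply: le_Rintegral => //.
- exact: integrable_norm.
- by apply: (@integrable_bounded (fun=> e) `|e|).
Qed.

End discretised_integral.

(** * The maximum mean discrepancy *)

Section mmd_theory.
Context {R : realType} {T : topologicalType} {t0 : T}.
Context {k : borel t0 -> borel t0 -> R} (H : rkhs k) (K : R).
Hypotheses (k_continuous : continuous (fun p : borel t0 * borel t0 => k p.1 p.2))
  (k_le_K : forall x, Num.sqrt (k x x) <= K).
Implicit Types Q : {measure set (borel t0) -> \bar R}.

Lemma rkhs_integrable Q h : Q setT = 1%E -> rkhs_fun H h ->
  Q.-integrable setT (EFin \o h).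
Proof.
move=> Q1 Hh; apply: (@integrable_bounded _ _ _ _ Q1 h (rkhs_norm H h * K)).
  by apply: continuous_borel_measurable; exact: (rkhs_continuous k_continuous Hh).
move=> x; apply: (le_trans (rkhs_le_norm x Hh)).
by rewrite ler_wpM2l ?rkhs_norm_ge0.
Qed.

Let int_fin Q h : Q setT = 1%E -> rkhs_fun H h ->
  (\int[Q]_x (h x)%:E = (\int[Q]_x h x)%R%:E)%E.
Proof.
move=> Q1 Hh; rewrite /Rintegral fineK//.
by apply: integrable_fin_num => //; exact: rkhs_integrable.
Qed.

Lemma mmd_leP Q1 Q2 e : Q1 setT = 1%E -> Q2 setT = 1%E ->
  (mmd H Q1 Q2 <= e%:E)%E <->
  (forall h, rkhs_fun H h -> rkhs_norm H h <= 1 ->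
    \int[Q1]_x h x - \int[Q2]_x h x <= e).
Proof.
move=> Q11 Q21; split => [mmd_e h Hh h1|le_e].
  rewrite -lee_fin EFinB -!int_fin//; apply: le_trans mmd_e.
  by apply: ereal_sup_ubound; exists h.
apply: ge_ereal_sup => _ [h [Hh h1] <-].
by rewrite !int_fin// -EFinB lee_fin le_e.
Qed.

(** The case of unit norm, rescaled; both signs of [h] are used. *)
Lemma mmd_le_dist Q1 Q2 e h : Q1 setT = 1%E -> Q2 setT = 1%E ->
  (mmd H Q1 Q2 <= e%:E)%E -> rkhs_fun H h ->
  `|\int[Q1]_x h x - \int[Q2]_x h x| <= rkhs_norm H h * e.
Proof.
move=> Q11 Q21 /(mmd_leP _ Q11 Q21) mmd_e Hh.
have [h0|h_neq0] := eqVneq (rkhs_norm H h) 0.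
  have h_eq0 x : h x = 0.
    apply/eqP; rewrite -normr_le0.
    by have := rkhs_le_norm x Hh; rewrite h0 mul0r.
  rewrite h0 mul0r (_ : h = cst 0); last exact/funext.
  by rewrite !Rintegral_cst// !mul0r subrr normr0.
have h_gt0 : 0 < rkhs_norm H h by rewrite lt_neqAle eq_sym h_neq0 rkhs_norm_ge0.
have le_scaled a : `|a| * rkhs_norm H h <= 1 ->
    a * (\int[Q1]_x h x - \int[Q2]_x h x) <= e.
  move=> a1; have [Hah ahE] := rkhs_normZ a Hh.
  have := mmd_e _ Hah; rewrite ahE => /(_ a1).
  by rewrite !RintegralZl ?mulrBr//; exact: rkhs_integrable.
rewrite ler_norml.
have [l1 l2] : `|(rkhs_norm H h)^-1| * rkhs_norm H h <= 1 /\
     `|- (rkhs_norm H h)^-1| * rkhs_norm H h <= 1.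
  by rewrite normrN ger0_norm ?invr_ge0 ?rkhs_norm_ge0// mulVf.
have := le_scaled _ l1; have := le_scaled _ l2.
rewrite mulNr -mulrN !ler_pdivrMl// => ? ->.
by rewrite lerNl andbT.
Qed.

(** Up to [2 * e], the MMD is the norm of the difference of the two mean feature
    vectors of the discretised distributions. *)
Lemma mmd_discretised Q1 Q2 (N : nat) (c : 'I_N -> borel t0)
    (r : borel t0 -> 'I_N) (w : 'I_N -> R) (e : R) :
  Q1 setT = 1%E -> Q2 setT = 1%E -> 0 <= e ->
  (forall a, measurable (r @^-1` [set a])) ->
  (forall x, kernel_dist2 (k := k) x (c (r x)) < e ^+ 2) ->
  (forall a, w a = fine (Q1 (r @^-1` [set a])) - fine (Q2 (r @^-1` [set a]))) ->
  (mmd H Q1 Q2 <= (2 * e + Num.sqrt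
     (\sum_(a < N) \sum_(b < N) w a * w b * k (c a) (c b)))%:E)%E.
Proof.
move=> Q11 Q21 e_ge0 mr rc wE; apply/mmd_leP => // h Hh h1.
have hc x : `|h x - h (c (r x))| <= e.
  apply: (le_trans (rkhs_le_dist _ _ Hh)).
  apply: (@le_trans _ _ (1 * e)); last by rewrite mul1r.
  rewrite ler_pM ?rkhs_norm_ge0 ?sqrtr_ge0//.
  by rewrite -(ger0_norm e_ge0) -sqrtr_sqr ler_wsqrtr// ltW.
have I1 := @integral_discretised _ _ _ _ Q11 _ _ mr _ (fun a => h (c a)) _
  (rkhs_integrable Q11 Hh) hc.
have I2 := @integral_discretised _ _ _ _ Q21 _ _ mr _ (fun a => h (c a)) _
  (rkhs_integrable Q21 Hh) hc.
have := @rkhs_point_combination _ _ _ H _ (index_enum 'I_N) w c h Hh.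
set W := Num.sqrt _ => Wh.
have {}Wh : \sum_(a < N) w a * h (c a) <= W.
  apply: (le_trans (ler_norm _)); apply: (le_trans Wh).
  by rewrite -[leRHS]mul1r ler_wpM2r ?sqrtr_ge0.
move: Wh I1 I2; under eq_bigr do rewrite wE mulrBl.
rewrite sumrB !ler_norml => Wh /andP[_ I1] /andP[I2 _].
lra.
Qed.

End mmd_theory.

(** * Concentration of the empirical distribution *)

(** A bound on the measures of the sets [E m] also bounds the measure of any
    measurable subset of their lower limit. *)
Lemma measure_eventually_le d (T : measurableType d) (R : realType)
    (mu : {measure set T -> \bar R}) (E : nat -> set T) (G : set T) (x : \bar R) :
  (forall m, measurable (E m)) -> (forall m, (mu (E m) <= x)%E) ->
  measurable G -> (forall t, G t -> \forall m \near \oo, E m t) ->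
  (mu G <= x)%E.
Proof.
move=> mE muE mG GE.
pose F N := \bigcap_(m in [set m | (N <= m)%N]) E m.
have mF N : measurable (F N).
  by apply: bigcap_measurable => //; exists N => /=.
have F_cvg : mu \o F @ \oo --> mu (\bigcup_N F N).
  apply: nondecreasing_cvg_mu => //; first exact: bigcup_measurable.
  move=> M N MN; apply/subsetPset => t FMt m /= Nm; apply: FMt => /=.
  exact: leq_trans MN Nm.
have mUF : measurable (\bigcup_N F N) by exact: bigcup_measurable.
apply: (@le_trans _ _ (mu (\bigcup_N F N))).
  (* the inclusion holds by unfolding: [GE] says that [t] is in some [F N] *)
  by apply: le_measure; rewrite ?inE.
apply: (cvge_to_le F_cvg); apply: nearW => N /=.
apply: le_trans (muE N); apply: le_measure; rewrite ?inE// => t; apply.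
exact: leqnn.
Qed.

Section discretised_sample.
Context d d' (Omega : measurableType d) (T : measurableType d') (R : realType).
Variables (mu : probability Omega R) (n : nat) (X : 'I_n -> {RV mu >-> T}).
Variables (P : probability T R) (X_iid : iid_sample X P).
Variables (N : nat) (r : T -> 'I_N).
Hypothesis mr : forall a, measurable (r @^-1` [set a]).

(** The cells of the samples are independent, hence an event on them has the
    probability that it has under the product of the cell probabilities. *)
Lemma discretised_sample_law (C : pred (n.-tuple 'I_N)) :
  let E := [set omega | C [tuple r (X i omega) | i < n]] in
  measurable E /\
  mu E = (\sum_(t : n.-tuple 'I_N | C t)
           \prod_(a <- t) fine (P (r @^-1` [set a])))%:E.
Proof.
move=> E.
pose cell (t : n.-tuple 'I_N) :=
  [set omega | forall i, i \in [set: 'I_n]%SET -> (r @^-1` [set tnth t i]) (X i omega)].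
have cellE t omega : cell t omega <-> t = [tuple r (X i omega) | i < n].
  split=> [tE|-> i _ /=]; last by rewrite tnth_mktuple.
  by apply: eq_from_tnth => i; rewrite tnth_mktuple -tE ?inE.
have mcell t : measurable (cell t).
  rewrite (_ : cell t = \bigcap_(i in [set: 'I_n]) (X i @^-1` (r @^-1` [set tnth t i]))).
    apply: fin_bigcap_measurable; first exact: finite_finset.
    move=> i _; rewrite -[X in measurable X]setTI.
    by apply: (measurable_funPT (X i)) => //; exact: mr.
  by apply/seteqP; split => omega h i _; apply: h; rewrite ?inE.
have EE : E = \bigcup_(t in [set t | C t]) cell t.
  apply/seteqP; split => omega.
    by move=> CE; exists [tuple r (X i omega) | i < n] => //; exact/cellE.
  by move=> [t Ct /cellE tE]; rewrite /E/= -tE.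
split.
  by rewrite EE; apply: fin_bigcup_measurable => //; exact: finite_finset.
rewrite EE measure_fin_bigcup//; first last.
- by move=> t u _ _ [omega [/cellE-> /cellE->]].
- exact: finite_finset.
rewrite (fsbigE (enum C)) ?enum_uniq//; first last.
- by move=> t /= Ct; rewrite mem_enum unfold_in Ct.
- by move=> t /=; rewrite mem_enum.
rewrite -sumEFin big_enum_cond/=; apply: eq_big => [t|t _].
  by rewrite -[t \in C]/(C t) andb_idr// => Ct; rewrite inE.
have [indep X_law] := X_iid.
rewrite [LHS](indep [set: 'I_n]%SET (fun i => r @^-1` [set tnth t i]))//.
rewrite big_tuple -prodEFin; apply: eq_big => [i|i _]; first by rewrite inE.
rewrite -[LHS]/(distribution mu (X i) (r @^-1` [set tnth t i])) X_law//.
by rewrite fineK// fin_num_measure.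
Qed.

End discretised_sample.

Section mmd_concentration.
Context {R : realType} {T : topologicalType} {t0 : T}.
Context {k : borel t0 -> borel t0 -> R} (H : rkhs k) (K : R).
Hypotheses (T_compact : compact [set: borel t0])
  (k_continuous : continuous (fun p : borel t0 * borel t0 => k p.1 p.2))
  (k_pd : pd_kernel k) (k_le_K : forall x, Num.sqrt (k x x) <= K).

Section gram.
Variables (N : nat) (c : 'I_N -> borel t0).

(** The inner product of the combinations of the feature vectors of the centres
    [c a] with coefficients [u] and [v]. *)
Definition gram_form (u v : 'rV[R]_N) : R :=
  \sum_(a < N) \sum_(b < N) u 0 a * v 0 b * k (c a) (c b).

Lemma gram_formC u v : gram_form u v = gram_form v u.
Proof.
rewrite /gram_form exchange_big/=; apply: eq_bigr => a _; apply: eq_bigr => b _.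
by rewrite k_pd.1 (mulrC (u 0 b)).
Qed.

Lemma gram_formDl x u v w :
  gram_form (x *: u + v) w = x * gram_form u w + gram_form v w.
Proof.
rewrite /gram_form mulr_sumr -big_split/=; apply: eq_bigr => a _.
rewrite mulr_sumr -big_split/=; apply: eq_bigr => b _.
by rewrite !mxE; ring.
Qed.

Lemma gram_form_ge0 u : 0 <= gram_form u u.
Proof. exact: k_pd.2. Qed.

Lemma gram_form_delta a : gram_form (delta_mx 0 a) (delta_mx 0 a) = k (c a) (c a).
Proof.
rewrite /gram_form (bigD1 a)//= (bigD1 a)//= !mxE !eqxx !mul1r.
rewrite [X in _ + X + _]big1 ?[X in _ + X]big1 ?addr0// => b b_a.
  by rewrite big1// => b' _; rewrite mxE (negbTE b_a) andbF !mul0r.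
by rewrite !mxE (negbTE b_a) andbF mulr0 mul0r.
Qed.
End gram.

Context d (Omega : measurableType d) (mu : probability Omega R).
Context (n : nat) (z : 'I_n -> {RV mu >-> borel t0}) (P : probability (borel t0) R).
Hypotheses (n_gt0 : (0 < n)%N) (z_iid : iid_sample z P).
Variable (L : R).
Hypothesis L_ge0 : 0 <= L.

(** With [L = ln (1 / delta)], the radius of the MMD ball is [K * rate]. *)
Let rate := (1 + Num.sqrt (2 * L)) / Num.sqrt n%:R.

(** The tail bound up to an arbitrary slack [e].  The slack covers the
    discretisation, and replaces [K] by [K + e], which is positive even when
    [K = 0]. *)
Let mmd_tail_slack (e : R) : 0 < e ->
  exists E : set Omega, [/\ measurable E, (mu E <= (expR (- L))%:E)%E &
    forall omega, ~ E omega ->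
      (mmd H P (empirical R (fun i => z i omega)) <=
       ((K + e) * rate + 2 * e)%:E)%E].
Proof.
move=> e_gt0.
have K_ge0 : 0 <= K by apply: le_trans (k_le_K t0); exact: sqrtr_ge0.
have Ke_gt0 : 0 < K + e by rewrite ltr_wpDl.
have [N [c [r [mr rc]]]] :=
  finite_discretisation T_compact k_continuous (exprn_gt0 2 e_gt0).
have n_gt0' : 0 < n%:R :> R by rewrite ltr0n.
pose cell a := r @^-1` [set a].
pose p a := fine (P (cell a)).
have p_ge0 a : 0 <= p a by apply: fine_ge0.
have p_sum1 : \sum_a p a = 1.
  have [_ ] := integral_finite_comp (@probability_setT _ _ _ P) mr (fun=> 1 : R).
  rewrite Rintegral_cst//= probability_setT/= mulr1 => ->.
  by apply: eq_bigr => a _; rewrite mulr1.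
pose B := gram_form c.
pose X a : 'rV[R]_N := delta_mx 0 a.
pose mean := \sum_a p a *: X a.
pose S (t : seq 'I_N) := \sum_(a <- t) (X a - mean).
have X_le a : seminorm B (X a) <= K + e.
  rewrite /seminorm /B /X gram_form_delta; apply: (le_trans (k_le_K (c a))).
  by rewrite lerDl ltW.
pose C (t : n.-tuple 'I_N) :=
  (K + e) * Num.sqrt n%:R * (1 + Num.sqrt (2 * L)) < seminorm B (S t).
have [mE muE] := discretised_sample_law z_iid mr C.
exists [set omega | C [tuple r (z i omega) | i < n]]; split=> //.
  rewrite muE lee_fin.
  exact: (hilbert_hoeffding (gram_formC c) (gram_formDl c) (gram_form_ge0 c)
    p_ge0 p_sum1 Ke_gt0 X_le n_gt0 L_ge0).
move=> omega /negP; rewrite -leNgt => le_S.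
set t := [tuple r (z i omega) | i < n] in le_S.
(* the difference of the mean feature vectors of [P] and of the samples *)
pose w : 'rV[R]_N := - n%:R^-1 *: S t.
have wE a : w 0 a = fine (P (cell a)) -
    fine (empirical R (fun i => z i omega) (cell a)).
  have meanE : mean 0 a = p a.
    rewrite /mean summxE (bigD1 a)//= big1 => [|b b_a].
      by rewrite !mxE !eqxx mulr1 addr0.
    by rewrite !mxE eq_sym (negbTE b_a) andbF mulr0.
  have -> : w 0 a = - n%:R^-1 * \sum_(i < n) ((r (z i omega) == a)%:R - p a).
    rewrite !mxE summxE big_tuple; congr (_ * _); apply: eq_bigr => i _.
    by rewrite tnth_mktuple mxE [(- mean) 0 a]mxE meanE mxE eqxx/= eq_sym.
  have -> : empirical R (fun i => z i omega) (cell a) =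
      (n%:R^-1 * \sum_(i < n) (r (z i omega) == a)%:R)%:E.
    rewrite /empirical EFinM -sumEFin; congr (_ * _)%E; apply: eq_bigr => i _.
    by rewrite diracE; congr ((nat_of_bool _)%:R)%:E; apply/idP/eqP; rewrite inE.
  rewrite sumrB sumr_const card_ord -[p a *+ n]mulr_natl mulrBr !mulNr opprK.
  rewrite mulKf ?gt_eqF//.
  by rewrite addrC.
have := mmd_discretised H k_continuous k_le_K (@probability_setT _ _ _ P)
  (empirical_setT R (fun i => z i omega) n_gt0) (ltW e_gt0) mr rc wE.
move=> /le_trans; apply; rewrite lee_fin addrC lerD2r.
rewrite -[leLHS]/(seminorm B w) /w seminormZ; last 2 first.
- exact: gram_formC.
- exact: gram_formDl.
rewrite normrN ger0_norm ?invr_ge0 ?ler0n// ler_pdivrMl//; apply: (le_trans le_S).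
rewrite /rate le_eqVlt; apply/orP/or_introl/eqP.
have r_gt0 : 0 < Num.sqrt n%:R :> R by rewrite sqrtr_gt0.
rewrite -{2}(sqr_sqrtr (ltW n_gt0')); field.
by rewrite gt_eqF.
Qed.

(** Measurability is asked of [G] only: nothing is claimed about the set of all
    outcomes for which the MMD exceeds [K * rate]. *)
Lemma mmd_empirical_tail (G : set Omega) : measurable G ->
  (forall omega, G omega ->
    ~ (mmd H P (empirical R (fun i => z i omega)) <= (K * rate)%:E)%E) ->
  (mu G <= (expR (- L))%:E)%E.
Proof.
move=> mG G_far.
have rate_ge0 : 0 <= rate by rewrite divr_ge0 ?addr_ge0 ?sqrtr_ge0.
have inv_gt0 m : 0 < m.+1%:R^-1 :> R by rewrite invr_gt0.
have [E /all_and3[mE muE E_near]] := choice (fun m => mmd_tail_slack (inv_gt0 m)).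
apply: (measure_eventually_le mE muE mG) => omega /G_far /negP.
rewrite -ltNge => lt_mmd.
have [y xy y_mmd] : exists2 y, K * rate < y &
    (y%:E <= mmd H P (empirical R (fun i => z i omega)))%E.
  case: (mmd _ _ _) lt_mmd => [y| |//]; first by rewrite lte_fin; exists y.
  by exists (K * rate + 1); rewrite ?ltrDl// leey.
have e_gt0 : 0 < (y - K * rate) / (rate + 2).
  by rewrite divr_gt0 ?subr_gt0// ltr_wpDl.
have := near_infty_natSinv_lt (PosNum e_gt0); apply: filterS => m /= lt_e.
apply: contrapT => /E_near; apply/negP; rewrite -ltNge.
apply: lt_le_trans y_mmd; rewrite lte_fin.
move: lt_e; rewrite ltr_pdivlMr; last by rewrite ltr_wpDl.
set v := _^-1; nra.
Qed.

End mmd_concentration.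

(** * The excess risk *)

Section risk_bound.
Context {R : realType} {T : topologicalType} {t0 : T}.
Context {k : borel t0 -> borel t0 -> R} (H : rkhs k) (K : R).
Hypotheses (k_continuous : continuous (fun p : borel t0 * borel t0 => k p.1 p.2))
  (k_le_K : forall x, Num.sqrt (k x x) <= K).

(** The expectations of [h] under [P] and under any distribution of the ball
    both differ from its integral under the centre [P0] by at most [M * eta]. *)
Lemma worst_case_risk_le (P : probability (borel t0) R)
    (P0 : {measure set (borel t0) -> \bar R}) (eta M : R) h :
  P0 setT = 1%E -> 0 <= eta -> mmd_ball H P0 eta P ->
  rkhs_fun H h -> rkhs_norm H h <= M ->
  (worst_case_risk H P0 eta h <= 'E_P[h] + (2 * M * eta)%:E)%E.
Proof.
move=> P01 eta_ge0 P_ball Hh hM; apply: ge_ereal_sup => _ [Q Q_ball <-].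
have EE (Q' : probability (borel t0) R) : ('E_Q'[h] = (\int[Q']_x h x)%R%:E)%E.
  rewrite expectation.unlock /Rintegral fineK//; apply: integrable_fin_num => //.
  exact: (rkhs_integrable k_continuous k_le_K (probability_setT Q') Hh).
have dist Q' : mmd_ball H P0 eta Q' ->
    `|\int[Q']_x h x - \int[P0]_x h x| <= M * eta.
  move=> Q'_ball; apply: le_trans (ler_wpM2r eta_ge0 hM).
  exact: (mmd_le_dist k_continuous k_le_K (probability_setT Q')).
rewrite !EE -EFinD lee_fin.
have := dist _ Q_ball; have := dist _ P_ball; rewrite !ler_norml.
move=> /andP[? _] /andP[_ ?]; lra.
Qed.

End risk_bound.

Theorem theorem4p1 (R : realType) (d : nat)
  (Z : set 'rV[R]_d) (Z_compact : compact Z) (z0 : Z)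
  (P : probability (borel z0) R)
  (* iid samples z_1, ..., z_n from P *)
  (dO : measure_display) (Omega : measurableType dO) (mu : probability Omega R)
  (n : nat) (n_gt0 : (0 < n)%N) (z : 'I_n -> {RV mu >-> borel z0})
  (z_iid : iid_sample z P)
  (* function class and loss *)
  (F : Type) (l : F -> borel z0 -> R)
  (l_defined : forall f, expectation_defined P (l f))
  (fstar : F) (fstar_argmin : argmin (fun f => 'E_P[l f]%E) fstar)
  (* kernel and RKHS *)
  (k : borel z0 -> borel z0 -> R)
  (k_bounded : bounded_fun (fun p : borel z0 * borel z0 => k p.1 p.2))
  (k_continuous : continuous (fun p : borel z0 * borel z0 => k p.1 p.2))
  (k_pd : pd_kernel k) (H : rkhs k)
  (K M : R)
  (k_le_K : sup (range (fun x : borel z0 => Num.sqrt (k x x))) <= K)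
  (lfstar_H : rkhs_fun H (l fstar)) (lfstar_le_M : rkhs_norm H (l fstar) <= M)
  (* MMD DRO problem *)
  (delta : R) (delta01 : 0 < delta < 1)
  (eta : R)
  (eta_def : eta = K / Num.sqrt n%:R * (1 + Num.sqrt (2 * ln (1 / delta))))
  (ball_defined : forall omega f (Q : probability (borel z0) R),
     mmd_ball H (empirical R (fun i => z i omega)) eta Q ->
     expectation_defined Q (l f))
  (max_attained : forall omega f,
     exists2 Q : probability (borel z0) R,
       mmd_ball H (empirical R (fun i => z i omega)) eta Q &
       'E_Q[l f]%E =
         worst_case_risk H (empirical R (fun i => z i omega)) eta (l f))
  (fdro : Omega -> F)
  (fdro_argmin : forall omega,
     argmin
       (fun f =>
          worst_case_risk H (empirical R (fun i => z i omega)) eta (l f))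
       (fdro omega)) :
  let good := [set omega |
    ('E_P[l (fdro omega)] - 'E_P[l fstar] <=
     (2 * K * M / Num.sqrt n%:R * (1 + Num.sqrt (2 * ln (1 / delta))))%:E)%E] in
  measurable good -> ((1 - delta)%:E <= mu good)%E.
Proof.
move=> good mgood.
have T_compact : compact [set: borel z0] by exact: compact_set_type.
have k_diag x : Num.sqrt (k x x) <= K.
  apply: le_trans k_le_K; apply: ub_le_sup; last by exists x.
  have [C [_ C_bound]] := k_bounded.
  exists (Num.sqrt (C + 1)) => _ [y _ <-]; apply: ler_wsqrtr.
  apply: (le_trans (ler_norm _)).
  by apply: (C_bound (C + 1) _ (y, y)) => //; rewrite ltrDl.
have K_ge0 : 0 <= K by apply: le_trans (k_diag z0); exact: sqrtr_ge0.
have /andP[delta_gt0 delta_lt1] := delta01.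
have L_ge0 : 0 <= ln (1 / delta).
  by rewrite ln_ge0// div1r invf_ge1// ltW.
have eta_ge0 : 0 <= eta.
  by rewrite eta_def mulr_ge0 ?divr_ge0 ?sqrtr_ge0// addr_ge0 ?sqrtr_ge0.
pose emp omega := empirical R (fun i => z i omega).
have close_good omega : (mmd H P (emp omega) <= eta%:E)%E -> good omega.
  move=> P_ball; rewrite /good/=.
  have lfstar_fin : ('E_P[l fstar])%E \is a fin_num.
    rewrite expectation.unlock; apply: integrable_fin_num => //.
    exact: (rkhs_integrable k_continuous k_diag (probability_setT P) lfstar_H).
  rewrite leeBlDr//.
  apply: (@le_trans _ _ (worst_case_risk H (emp omega) eta (l (fdro omega)))).
    by apply: ereal_sup_ubound; exists P.
  apply: (le_trans (fdro_argmin omega fstar)).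
  have := worst_case_risk_le k_continuous k_diag
    (empirical_setT R (fun i => z i omega) n_gt0) eta_ge0 P_ball lfstar_H lfstar_le_M.
  rewrite addeC; congr (_ <= _%:E + _)%E; rewrite eta_def; ring.
have mu_bad : (mu (~` good) <= delta%:E)%E.
  have <- : expR (- ln (1 / delta)) = delta.
    by rewrite div1r lnV ?posrE// opprK lnK.
  apply: (mmd_empirical_tail T_compact k_continuous k_pd k_diag n_gt0 z_iid L_ge0).
    exact: measurableC.
  move=> omega bad; apply: contra_not bad => le_K; apply: close_good.
  by move: le_K; congr (_ <= _%:E)%E; rewrite eta_def; ring.
have -> : mu good = (1 - mu (~` good))%E.
  by rewrite -(probability_setC mu (measurableC mgood)) setCK.
by rewrite EFinB leeB.
Qed.
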